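(* Let $X$ be a metric space. (i) Let $n\geq 2$. If $X$ is geodesic and $m\geq 2n-2$, then any two points of $FS_n(X)$ can be connected by a geodesic in $FS_m(X)$. (ii) $X$ is geodesic if and only if $FS_2(X)$ is geodesic. (iii) If $X$ is geodesic, then so is $FS(X)$.
   Context: $FS(X)$ is the set of nonempty finite subsets of $X$ and, for an integer $n\geq1$, $FS_n(X)$ is the set of nonempty subsets of $X$ with at most $n$ elements; both are metric spaces with the Hausdorff distance $d_H(A,B)=\max\{\max_{a\in A}\min_{b\in B}d(a,b),\ \max_{b\in B}\min_{a\in A}d(a,b)\}$. A geodesic in a metric space $Y$ from $y$ to $y'$ is a continuous map $\gamma:[0,1]\to Y$ with $\gamma(0)=y$, $\gamma(1)=y'$ and $d(\gamma(t),\gamma(t'))\leq d(y,y')|t-t'|$ for all $t,t'\in[0,1]$. A metric space is geodesic if every two of its points are connected by a geodesic in it. *)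

(* Defs.v *)
From HB Require Import structures.
From mathcomp Require Import all_boot all_order all_algebra finmap.
From mathcomp Require Import all_classical all_reals topology.

Set Implicit Arguments.
Unset Strict Implicit.
Unset Printing Implicit Defensive.

Import Order.TTheory GRing.Theory Num.Theory.
Import numFieldTopology.Exports.

Local Open Scope classical_set_scope.
Local Open Scope fset_scope.
Local Open Scope ring_scope.

Section Geodesic.
Context {R : realType} (Y : metricType R).

(* A map [0, 1] -> Y is given as a map R -> Y; its values outside [0, 1] are
   unconstrained. *)
Definition geodesic (y y' : Y) (g : R -> Y) : Prop :=
  [/\ {within `[0, 1], continuous g},
      g 0 = y,
      g 1 = y' &
      {in `[0, 1] &, forall t t', mdist (g t) (g t') <= mdist y y' * `|t - t'|}].

Definition geodesic_space : Prop := forall y y' : Y, exists g, geodesic y y' g.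

End Geodesic.

Section HausdorffDistance.
Context {R : realType} {X : metricType R}.
Implicit Types (A B C : {fset X}) (a b : X) (e : R).

(* For nonempty B, the seed of the minimum is itself the distance from a to a
   point of B. *)
Definition mindist a B : R :=
  \big[Num.min/mdist a (head a B)]_(b <- B) mdist a b.

(* The seed 0 is harmless because distances are nonnegative. *)
Definition maxmindist A B : R := \big[Num.max/0]_(a <- A) mindist a B.

Definition hausdist A B : R := Num.max (maxmindist A B) (maxmindist B A).

Lemma mindist_le a b B : b \in B -> mindist a B <= mdist a b.
Proof. by move=> bB; rewrite /mindist; exact: ge_bigmin_seq. Qed.

Lemma mindist_attained a B : B != fset0 ->
  exists2 b, b \in B & mindist a B = mdist a b.
Proof.
move=> B0; rewrite /mindist.
have hB : head a B \in B.
  have /fset0Pn[x] := B0.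
  have in_head (s : seq X) : x \in s -> head a s \in s.
    by case: s => //= y s _; exact: mem_head.
  exact: in_head.
rewrite big_seq; apply: (big_ind (fun r => exists2 b, b \in B & r = mdist a b)).
- by exists (head a B).
- move=> _ _ [b bB ->] [c cB ->]; rewrite /Num.min /Order.min.
  by case: ifP => _; [exists b | exists c].
- by move=> b bB; exists b.
Qed.

Lemma maxmindist_ge0 A B : 0 <= maxmindist A B.
Proof. exact: bigmax_ge_id. Qed.

Lemma maxmindist_leP A B e : B != fset0 -> 0 <= e ->
  maxmindist A B <= e <->
  {in A, forall a, exists2 b, b \in B & mdist a b <= e}.
Proof.
move=> B0 e0; rewrite /maxmindist; split.
  move=> le_e a aA; have [b bB ab] := mindist_attained a B0.
  exists b => //; rewrite -ab; apply: le_trans le_e.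
  exact:
    (@Order.TotalTheory.le_bigmax_seq _ _ _ (enum_fset A) 0 a xpredT (mindist^~ B)).
move=> near; rewrite big_seq; apply: bigmax_le => // a aA.
by have [b bB] := near _ aA; apply: le_trans; exact: mindist_le.
Qed.

Lemma hausdist_ge0 A B : 0 <= hausdist A B.
Proof. by rewrite le_max maxmindist_ge0. Qed.

Lemma hausdist_leP A B e : A != fset0 -> B != fset0 -> 0 <= e ->
  hausdist A B <= e <->
  {in A, forall a, exists2 b, b \in B & mdist a b <= e} /\
  {in B, forall b, exists2 a, a \in A & mdist b a <= e}.
Proof.
move=> A0 B0 e0; rewrite ge_max; split.
  by move=> /andP[/maxmindist_leP ? /maxmindist_leP ?]; split; auto.
by move=> [? ?]; apply/andP; split; apply/maxmindist_leP.
Qed.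

Lemma hausdist_sym A B : hausdist A B = hausdist B A.
Proof. by rewrite /hausdist maxC. Qed.

Lemma hausdistxx A : A != fset0 -> hausdist A A = 0.
Proof.
move=> A0; apply/eqP; rewrite eq_le hausdist_ge0 andbT; apply/hausdist_leP => //.
by split=> a aA; exists a => //; rewrite mdistxx.
Qed.

Lemma hausdist_positivity A B : A != fset0 -> B != fset0 ->
  hausdist A B = 0 -> A = B.
Proof.
move=> A0 B0 AB0; have /hausdist_leP : hausdist A B <= 0 by rewrite AB0.
move=> /(_ A0 B0 (lexx _))[AB BA].
have eq0 (x y : X) : mdist x y <= 0 -> x = y.
  by move=> xy; apply/mdist_positivity/eqP; rewrite eq_le xy mdist_ge0.
apply/eqP; rewrite eqEfsubset; apply/andP; split; apply/fsubsetP => x.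
  by move=> /AB[y yB /eq0 ->].
by move=> /BA[y yA /eq0 ->].
Qed.

Lemma hausdist_triangle B A C : A != fset0 -> B != fset0 -> C != fset0 ->
  hausdist A C <= hausdist A B + hausdist B C.
Proof.
move=> A0 B0 C0; apply/hausdist_leP => //; first by rewrite addr_ge0// hausdist_ge0.
have /(hausdist_leP A0 B0 (hausdist_ge0 A B))[AB BA] := lexx (hausdist A B).
have /(hausdist_leP B0 C0 (hausdist_ge0 B C))[BC CB] := lexx (hausdist B C).
split=> x.
  move=> /AB[y /BC[z zC yz] xy]; exists z => //.
  by rewrite (le_trans (metric_triangle _ y _))// lerD.
move=> /CB[y /BA[z zA yz] xy]; exists z => //.
by rewrite (le_trans (metric_triangle _ y _))// addrC lerD.
Qed.

End HausdorffDistance.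

Section FiniteSubsets.
Context {R : realType} (X : metricType R).

Record FS := MkFS { FS_val :> {fset X}; FS_neq0 : FS_val != fset0 }.

HB.instance Definition _ := [isSub for FS_val].
HB.instance Definition _ := [Choice of FS by <:].
HB.instance Definition _ := @isMetric.Build R FS
  (fun A B : FS => hausdist A B)
  (fun A => hausdistxx (FS_neq0 A))
  (fun A B AB0 => val_inj (hausdist_positivity (FS_neq0 A) (FS_neq0 B) AB0))
  (fun A B => hausdist_sym A B)
  (fun B A C => hausdist_triangle (FS_neq0 A) (FS_neq0 B) (FS_neq0 C)).

Record FSn (n : nat) := MkFSn {
  FSn_val :> {fset X};
  FSnP : (FSn_val != fset0) && (#|` FSn_val| <= n)%N }.

Section Instances.
Variable n : nat.

HB.instance Definition _ := [isSub for @FSn_val n].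
HB.instance Definition _ := [Choice of FSn n by <:].

Lemma FSn_neq0 (A : FSn n) : FSn_val A != fset0.
Proof. by case/andP: (FSnP A). Qed.

Lemma FSn_card (A : FSn n) : (#|` FSn_val A| <= n)%N.
Proof. by case/andP: (FSnP A). Qed.

HB.instance Definition _ := @isMetric.Build R (FSn n)
  (fun A B : FSn n => hausdist A B)
  (fun A => hausdistxx (FSn_neq0 A))
  (fun A B AB0 => val_inj (hausdist_positivity (FSn_neq0 A) (FSn_neq0 B) AB0))
  (fun A B => hausdist_sym A B)
  (fun B A C => hausdist_triangle (FSn_neq0 A) (FSn_neq0 B) (FSn_neq0 C)).

End Instances.

Lemma FSn_widen_subproof n m (le_nm : (n <= m)%N) (A : FSn n) :
  (FSn_val A != fset0) && (#|` FSn_val A| <= m)%N.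
Proof. by rewrite FSn_neq0 (leq_trans (FSn_card A)). Qed.

Definition FSn_widen n m (le_nm : (n <= m)%N) (A : FSn n) : FSn m :=
  MkFSn (FSn_widen_subproof le_nm A).

End FiniteSubsets.

Lemma leq_double_sub2 n m : (2 <= n)%N -> (2 * n - 2 <= m)%N -> (n <= m)%N.
Proof.
move=> n2; apply: leq_trans.
by rewrite mul2n -addnn -addnBA// leq_addr.
Qed.

(* Main.v *)
Require Import Defs.
From mathcomp Require Import all_boot all_order all_algebra finmap.
From mathcomp Require Import all_classical all_reals topology.
From mathcomp Require Import lra zify.

(** From [X] to its finite subsets.  The definition of the Hausdorff distance
    makes being at distance at most [d_H(A, B)] a relation between [A] and [B]
    in which every point of either set has a partner in the other.  Moving along
    a geodesic of [X] for each pair of a subfamily [C] of this relation that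
    still covers both sets gives a path from [A] to [B] in which partners move
    with speed at most [d_H(A, B)], hence a geodesic of finite sets with at most
    [#|C|] points ([interpolation]).  It remains to cover economically.  A
    cover that forms a forest with [k] components has [#|A| + #|B| - k] pairs.
    If both sets have at least two points, one can have [k >= 2], which gives at
    most [2n - 2]; if one of them is a singleton, then the cover is a single
    star with at most [n <= 2n - 2] pairs ([small_correspondence]).

    From finite subsets to [X].  A geodesic [G] from [{x}] to [{y}] is a
    Lipschitz family of finite sets, and a selection [f t \in G t] with the same
    Lipschitz constant is a geodesic from [x] to [y].  On finitely many times,
    such a selection is found greedily, from one time to the next: the Hausdorff
    distance provides a close enough point at each step, and the triangle
    inequality adds up along the line ([sorted_selection]).  Finite selections
    are glued into a global one by compactness of a product of finite sets
    ([finite_selection_compactness]).  The argument does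
    not look at the number of points, so it recovers [X] from [FS_n] for every
    [n >= 1]. *)

Set Implicit Arguments.
Unset Strict Implicit.
Unset Printing Implicit Defensive.

Import Order.TTheory GRing.Theory Num.Theory.
Import numFieldTopology.Exports.

Local Open Scope classical_set_scope.
Local Open Scope fset_scope.
Local Open Scope ring_scope.

(** * Economical covers by related pairs *)

(** The point of this lemma is the case where both sets have at least two
    elements: a choice of partners with two distinct values then exists, since a
    constant choice can be corrected at one element of [A], namely at a partner
    of an element of [B] that the constant misses.  The minimum also accounts
    for singletons, where every choice will do. *)
Lemma nonconstant_choice (T U : choiceType) (A : {fset T}) (B : {fset U})
    (r : T -> U -> Prop) :
  {in A, forall a, exists2 b, b \in B & r a b} ->
  {in B, forall b, exists2 a, a \in A & r a b} ->
  A != fset0 ->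
  exists f : T -> U,
    {in A, forall a, f a \in B /\ r a (f a)} /\
    (minn 2 (minn #|` A| #|` B|) <= #|` [fset f a | a in A]|)%N.
Proof.
move=> AB BA A0; have [a0 a0A] := fset0Pn _ A0; have [b0 b0B rab0] := AB _ a0A.
have [f fP] : {f : T -> U & forall a, a \in A -> f a \in B /\ r a (f a)}.
  apply: (@choice _ _ (fun a b => a \in A -> b \in B /\ r a b)) => a.
  have [aA|_] := boolP (a \in A); last by exists b0.
  by have [b bB rab] := AB _ aA; exists b.
have two (h : T -> U) a a' : a \in A -> a' \in A -> h a != h a' ->
    (2 <= #|` [fset h a | a in A]|)%N.
  move=> aA a'A haa'; rewrite -[X in (X <= _)%N]/(true.+1) -haa' -cardfs2.
  apply: fsubset_leq_card; apply/fsubsetP => _ /fset2P[->|->];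
    exact: in_imfset.
have [A1|A2] := leqP #|` A| 1.
  exists f; split => //; suff: (0 < #|` [fset f a | a in A]|)%N by lia.
  by rewrite cardfs_gt0; apply/fset0Pn; exists (f a0); exact: in_imfset.
have [B1|B2] := leqP #|` B| 1.
  exists f; split => //; suff: (0 < #|` [fset f a | a in A]|)%N by lia.
  by rewrite cardfs_gt0; apply/fset0Pn; exists (f a0); exact: in_imfset.
have [b1 b1B b1f] : exists2 b, b \in B & b != f a0.
  have /fset0Pn[b] : B `\ f a0 != fset0.
    by rewrite -cardfs_gt0; have := cardfsD1 (f a0) B; case: (_ \in _); lia.
  by rewrite !inE => /andP[? ?]; exists b.
have [a1 a1A ra1b1] := BA _ b1B.
have [a2 a2A a21] : exists2 a, a \in A & a != a1.
  have /fset0Pn[a] : A `\ a1 != fset0.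
    by rewrite -cardfs_gt0; have := cardfsD1 a1 A; case: (_ \in _); lia.
  by rewrite !inE => /andP[? ?]; exists a.
have [fa2|fa2] := eqVneq (f a2) b1.
  by exists f; split => //; rewrite geq_min (two f a2 a0)// fa2.
exists (fun a => if a == a1 then b1 else f a); split.
  by move=> a aA; case: eqVneq => [->|_]; [|exact: fP].
rewrite geq_min (two _ a2 a1)//.
by rewrite (negbTE a21) eqxx.
Qed.

(** Joining each [a] to [f a], and then each element of [B] missed by [f] to a
    partner of its own, costs [#|A| + #|B| - #|f(A)|] pairs; hence the interest
    of an [f] with two values. *)
Lemma small_correspondence (T U : choiceType) (A : {fset T}) (B : {fset U})
    (r : T -> U -> Prop) :
  {in A, forall a, exists2 b, b \in B & r a b} ->
  {in B, forall b, exists2 a, a \in A & r a b} ->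
  A != fset0 ->
  exists C : seq (T * U),
    [/\ {in C, forall p, [/\ p.1 \in A, p.2 \in B & r p.1 p.2]},
        {in A, forall a, exists b, (a, b) \in C},
        {in B, forall b, exists a, (a, b) \in C} &
        (size C + minn 2 (minn #|` A| #|` B|) <= #|` A| + #|` B|)%N].
Proof.
move=> AB BA A0; have [f [fP fcard]] := nonconstant_choice AB BA A0.
have [a0 a0A] := fset0Pn _ A0.
have [g gP] : {g : U -> T & forall b, b \in B -> g b \in A /\ r (g b) b}.
  apply: (@choice _ _ (fun b a => b \in B -> a \in A /\ r a b)) => b.
  have [bB|_] := boolP (b \in B); last by exists a0.
  by have [a aA rab] := BA _ bB; exists a.
set fA := [fset f a | a in A] in fcard.
have fAB : fA `<=` B.
  by apply/fsubsetP => _ /imfsetP[a /= aA ->]; have [] := fP _ aA.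
exists ([seq (a, f a) | a <- A] ++ [seq (g b, b) | b <- B `\` fA]); split.
- move=> p; rewrite mem_cat => /orP[] /mapP[x xP ->] /=.
    by have [] := fP _ xP.
  by move: xP; rewrite inE => /andP[_ xB]; have [] := gP _ xB.
- by move=> a aA; exists (f a); rewrite mem_cat map_f.
- move=> b bB; have [/imfsetP[a /= aA ->]|bfA] := boolP (b \in fA).
    by exists a; rewrite mem_cat map_f.
  exists (g b); rewrite mem_cat; apply/orP; right.
  by apply/mapP; exists b => //; rewrite inE bfA.
- have := fsubset_leq_card fAB.
  rewrite size_cat !size_map cardfsDS//; lia.
Qed.

(** * Geodesics of finite subsets *)

(** Continuity is automatic: the scale [e / (mdist y y' + 1)] also works when
    the endpoints coincide. *)
Lemma lipschitz_geodesic (R : realType) (Y : metricType R) (y y' : Y)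
    (g : R -> Y) :
  g 0 = y -> g 1 = y' ->
  {in `[0, 1] &, forall t t', mdist (g t) (g t') <= mdist y y' * `|t - t'|} ->
  geodesic y y' g.
Proof.
move=> g0 g1 glip; split=> //.
apply/subspace_continuousP => s s01.
apply/metricType_numDomainType.cvgrPdist_lt => e e0.
have D1 : 0 < mdist y y' + 1 by rewrite ltr_wpDl// mdist_ge0.
rewrite near_withinE; apply/nbhs_ballP.
exists (e / (mdist y y' + 1)) => [/=|t /= st t01]; first by rewrite divr_gt0.
apply: (le_lt_trans (glip _ _ s01 t01)).
rewrite /ball /= ltr_pdivlMr// mulrC in st.
by apply: le_lt_trans st; rewrite ler_wpM2r// lerDl.
Qed.

Section Interpolation.
Context {R : realType} {X : metricType R}.

(** All pairs of [C] move at once, so a point of [h t] and the point of [h t']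
    on the same geodesic are within [hausdist A B * `|t - t'|]. *)
Lemma interpolation (A B : {fset X}) (C : seq (X * X)) :
  geodesic_space X -> A != fset0 ->
  {in C, forall p, [/\ p.1 \in A, p.2 \in B & mdist p.1 p.2 <= hausdist A B]} ->
  {in A, forall a, exists b, (a, b) \in C} ->
  {in B, forall b, exists a, (a, b) \in C} ->
  exists h : R -> {fset X},
    [/\ h 0 = A, h 1 = B,
        forall t, (h t != fset0) && (#|` h t| <= size C)%N &
        {in `[0, 1] &, forall t t',
          hausdist (h t) (h t') <= hausdist A B * `|t - t'|}].
Proof.
move=> Xgeo A0 CP AC BC.
have [G GP] : {G : X * X -> R -> X & forall p, geodesic p.1 p.2 (G p)}.
  by apply: (@choice _ _ (fun p => geodesic p.1 p.2)) => p; exact: Xgeo.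
pose h t := [fset x in [seq G p t | p <- C]].
have hP t x : reflect (exists2 p, p \in C & x = G p t) (x \in h t).
  by rewrite inE; exact: mapP.
have h0 t : h t != fset0.
  have [a aA] := fset0Pn _ A0; have [b abC] := AC _ aA.
  by apply/fset0Pn; exists (G (a, b) t); apply/hP; exists (a, b).
have near t t' : t \in `[0, 1] -> t' \in `[0, 1] -> {in h t, forall x,
    exists2 x', x' \in h t' & mdist x x' <= hausdist A B * `|t - t'|}.
  move=> t01 t'01 _ /hP[p pC ->]; exists (G p t'); first by apply/hP; exists p.
  have [_ _ _ /(_ _ _ t01 t'01)/le_trans] := GP p; apply.
  by rewrite ler_wpM2r//; have [] := CP _ pC.
exists h; split=> [||t|t t' t01 t'01].
- apply/fsetP => x; apply/hP/idP => [[p pC ->]|xA].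
    by have [_ -> _ _] := GP p; have [] := CP _ pC.
  by have [b xbC] := AC _ xA; exists (x, b) => //; have [_ -> _ _] := GP (x, b).
- apply/fsetP => x; apply/hP/idP => [[p pC ->]|xB].
    by have [_ _ -> _] := GP p; have [] := CP _ pC.
  by have [a axC] := BC _ xB; exists (a, x) => //; have [_ _ -> _] := GP (a, x).
- by rewrite h0 card_fseq (leq_trans (size_undup _))// size_map.
- apply/hausdist_leP => //; first by rewrite mulr_ge0// hausdist_ge0.
  by split; [|rewrite distrC]; exact: near.
Qed.

Lemma interpolation_card (A B : {fset X}) :
  geodesic_space X -> A != fset0 -> B != fset0 ->
  exists h : R -> {fset X},
    [/\ h 0 = A, h 1 = B,
        forall t, (h t != fset0) &&
          (#|` h t| + minn 2 (minn #|` A| #|` B|) <= #|` A| + #|` B|)%N &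
        {in `[0, 1] &, forall t t',
          hausdist (h t) (h t') <= hausdist A B * `|t - t'|}].
Proof.
move=> Xgeo A0 B0.
have /(hausdist_leP A0 B0 (hausdist_ge0 A B))[AB BA] := lexx (hausdist A B).
have [] := @small_correspondence _ _ A B
  (fun a b => mdist a b <= hausdist A B) AB _ A0.
  by move=> b /BA[a aA]; rewrite metric_sym; exists a.
move=> C [CP AC BC sizeC].
have [h [h0 h1 hcard hlip]] := interpolation Xgeo A0 CP AC BC.
exists h; split => // t; have /andP[-> /=] := hcard t.
by move=> htC; apply: leq_trans sizeC; rewrite leq_add2r.
Qed.

End Interpolation.

(** * Compactness of finite choices *)

(** One of finitely many fibers is large, by induction on the list of values. *)
Lemma ultra_mem_fiber (T : Type) (X : eqType) (F : set_system T) (s : seq X)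
    (u : T -> X) :
  UltraFilter F -> (forall t, u t \in s) ->
  exists2 x, x \in s & F [set t | u t = x].
Proof.
move=> FU us.
have : F [set t | u t \in s] by apply: filterS filterT => t _; exact: us.
elim: s {us} => [|x s IHs] Fs; first by have [t] := filter_ex Fs.
have [Fx|FNx] := in_ultra_setVsetC [set t | u t = x] FU.
  by exists x; rewrite ?mem_head.
have [|y ys Fy] := IHs; last by exists y; rewrite // inE ys orbT.
apply: filterS (filterI Fs FNx) => t [/=]; rewrite inE => /orP[/eqP//|//].
Qed.

(** A form of Rado's selection principle for binary constraints.  The
    global choice at [i] is the value that most finite choices take at [i], with
    respect to an ultrafilter on the finite sets of indices in which, for each
    finite set, most finite sets contain it. *)
Lemma finite_selection_compactness (I X : eqType) (S : I -> seq X)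
    (r : I -> I -> X -> X -> Prop) :
  (forall T : seq I, exists f : I -> X,
    (forall i, f i \in S i) /\ {in T &, forall i j, r i j (f i) (f j)}) ->
  exists f : I -> X,
    (forall i, f i \in S i) /\ (forall i j, r i j (f i) (f j)).
Proof.
move=> /choice[u uP].
pose above (T0 : seq I) := [set T : seq I | {subset T0 <= T}].
have aboveF : ProperFilter (filter_from setT above).
  apply: filter_from_proper; last by move=> T0 _; exists T0.
  apply: filter_from_filter => [|T0 T1 _ _]; first by exists [::].
  exists (T0 ++ T1) => // T sub01.
  by split=> i iT; apply: sub01; rewrite mem_cat iT ?orbT.
have [F [FU aboveF_F]] := ultraFilterLemma aboveF.
have [f fP] : {f : I -> X & forall i, f i \in S i /\ F [set T | u T i = f i]}.
  apply: (@choice _ _ (fun i x => x \in S i /\ F [set T | u T i = x])) => i.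
  have [|x xS Fx] := @ultra_mem_fiber _ _ F (S i) (u^~ i) FU; last by exists x.
  by move=> T; have [] := uP T.
exists f; split=> [i|i j]; first by have [] := fP i.
have FT : F (above [:: i; j]) by apply: aboveF_F; exists [:: i; j].
have [_ Fi] := fP i; have [_ Fj] := fP j.
have [T [[/= <- <-] sub_ijT]] := filter_ex (filterI (filterI Fi Fj) FT).
by have [_] := uP T; apply; apply: sub_ijT; rewrite !inE eqxx ?orbT.
Qed.

(** * Lipschitz selections *)

Section Selection.
Context {R : realType} {X : metricType R}.

Lemma hausdist_near (A B : {fset X}) (e : R) (a : X) :
  B != fset0 -> hausdist A B <= e -> a \in A ->
  exists2 b, b \in B & mdist a b <= e.
Proof.
move=> B0 ABe aA; have A0 : A != fset0 by apply/fset0Pn; exists a.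
have e0 := le_trans (hausdist_ge0 A B) ABe.
by have /(hausdist_leP A0 B0 e0)[/(_ a aA)] := ABe.
Qed.

(** Extending the selection to an earlier time [t0] only requires a point close
    to the selected point at the next time [t1]: for later [t] the triangle
    inequality goes through [t1], and [`|t0 - t| = `|t0 - t1| + `|t1 - t|]. *)
Lemma sorted_selection (G : R -> {fset X}) (D : R) (s : seq R) :
  (forall t, G t != fset0) ->
  (forall t t', hausdist (G t) (G t') <= D * `|t - t'|) ->
  sorted <%R s ->
  exists f : R -> X, (forall t, f t \in G t) /\
    {in s &, forall t t', mdist (f t) (f t') <= D * `|t - t'|}.
Proof.
move=> G0 Glip; elim: s => [_|t0 s IHs].
  have [f fP] : {f : R -> X & forall t, f t \in G t}.
    by apply: (@choice _ _ (fun t x => x \in G t)) => t; apply/fset0Pn.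
  by exists f.
rewrite /= lt_path_sortedE => /andP[/allP t0s s_sorted].
have [f [fG flip]] := IHs s_sorted.
have [b bG bf] : exists2 b, b \in G t0 &
    {in s, forall t, mdist b (f t) <= D * `|t0 - t|}.
  case: s => [|t1 s] in t0s s_sorted flip {IHs} *.
    by exists (f t0).
  have [b bG fb] := hausdist_near (G0 t0) (Glip t1 t0) (fG t1).
  have t01 : t0 < t1 by rewrite t0s ?mem_head.
  exists b => // t ts; apply: le_trans (metric_triangle _ (f t1) _) _.
  have t1t : t1 <= t.
    move: ts; rewrite inE => /predU1P[->//|ts].
    by move: s_sorted; rewrite /= lt_path_sortedE => /andP[/allP/(_ _ ts)/ltW].
  have -> : `|t0 - t| = `|t1 - t0| + `|t1 - t|.
    by rewrite (ltr0_norm (x := t0 - t)) ?(gtr0_norm (x := t1 - t0))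
      ?(ler0_norm (x := t1 - t)); lra.
  by rewrite mulrDr lerD// ?flip ?mem_head// metric_sym.
exists (fun t => if t == t0 then b else f t); split.
  by move=> t; case: eqP => [->|].
move=> t t'; rewrite !inE.
have [->|_] := eqVneq t t0; have [->|_] := eqVneq t' t0 => //=.
- by rewrite mdistxx subrr normr0 mulr0.
- by move=> _; exact: bf.
- by move=> ts _; rewrite metric_sym distrC; exact: bf.
- exact: flip.
Qed.

(** A Lipschitz estimate is a family of constraints on pairs of times, so
    compactness glues the selections on finite sets of times. *)
Lemma lipschitz_selection (G : R -> {fset X}) (D : R) :
  (forall t, G t != fset0) ->
  (forall t t', hausdist (G t) (G t') <= D * `|t - t'|) ->
  exists f : R -> X, (forall t, f t \in G t) /\
    (forall t t', mdist (f t) (f t') <= D * `|t - t'|).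
Proof.
move=> G0 Glip.
apply: (@finite_selection_compactness _ _ (fun t => enum_fset (G t))
  (fun t t' x x' => mdist x x' <= D * `|t - t'|)) => T.
have [|f [fG flip]] :=
  @sorted_selection G D (sort <=%R (undup T)) G0 Glip.
  by rewrite sort_lt_sorted undup_uniq.
by exists f; split => // t t' tT t'T; apply: flip; rewrite mem_sort mem_undup.
Qed.

(** The endpoints of a selection are forced, because the geodesic of sets
    joins two singletons. *)
Lemma geodesic_of_FSn (n : nat) :
  (0 < n)%N -> geodesic_space (FSn X n) -> geodesic_space X.
Proof.
move=> n0 FSgeo x y.
have P z : ([fset z] != fset0 :> {fset X}) && (#|` [fset z]| <= n)%N.
  by rewrite cardfs1 n0 andbT; apply/fset0Pn; exists z; rewrite inE.
have [g [_ g0 g1 glip]] := FSgeo (MkFSn (P x)) (MkFSn (P y)).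
have xy : hausdist [fset x] [fset y] <= mdist x y.
  have [/andP[x0 _] /andP[y0 _]] := (P x, P y).
  apply/hausdist_leP; rewrite ?mdist_ge0//; split=> z /fset1P ->.
    by exists y; rewrite ?inE.
  by exists x; rewrite ?inE// metric_sym.
(* Clamping the time to [0, 1] makes the family Lipschitz on the whole line. *)
pose c (t : R) := Num.max 0 (Num.min 1 t).
have c01 t : c t \in `[0, 1].
  by rewrite in_itv /= /c le_max lexx ge_max ler01 ge_min lexx.
have clip t t' : `|c t - c t'| <= `|t - t'|.
  rewrite /c.
  have tt' := ler_norm (t - t'); have := ler_norm (t' - t); rewrite distrC => t't.
  case: (leP 1 t) => ?; case: (leP 1 t') => ?; rewrite ?(max_r ler01);
  try (case: (leP 0 t) => ?); try (case: (leP 0 t') => ?); rewrite ler_norml; lra.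
have [|t t'|f [fG flip]] :=
    @lipschitz_selection (fun t => FSn_val (g (c t))) (mdist x y).
- by move=> t; exact: FSn_neq0.
- apply: le_trans (glip _ _ (c01 t) (c01 t')) _.
  by rewrite ler_pM// ?mdist_ge0.
exists f; apply: lipschitz_geodesic => [||t t' _ _]; last exact: flip.
- have := fG 0.
  by rewrite /c min_r ?ler01// maxxx g0 => /fset1P.
- have := fG 1.
  by rewrite /c minxx max_r ?ler01// g1 => /fset1P.
Qed.

End Selection.

(** * Geodesicity of the spaces of finite subsets *)

Theorem corollary4p6 (R : realType) (X : metricType R) :
  [/\ forall (n m : nat) (hn : (2 <= n)%N) (hm : (2 * n - 2 <= m)%N),
        geodesic_space X ->
        forall A B : FSn X n,
          let le_nm := leq_double_sub2 hn hm in
          exists g : R -> FSn X m,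
            geodesic (FSn_widen le_nm A) (FSn_widen le_nm B) g,
      geodesic_space X <-> geodesic_space (FSn X 2) &
      geodesic_space X -> geodesic_space (FS X)].
Proof.
(* Keeping the proof of [n <= m] arbitrary lets this serve for [n = m = 2], where
   widening is the identity. *)
have FSn_geodesic n m (hn : (2 <= n)%N) (hm : (2 * n - 2 <= m)%N)
    (le_nm : (n <= m)%N) (A B : FSn X n) : geodesic_space X ->
    exists g : R -> FSn X m, geodesic (FSn_widen le_nm A) (FSn_widen le_nm B) g.
  move=> Xgeo.
  have [h [h0 h1 hcard hlip]] :=
    interpolation_card Xgeo (FSn_neq0 A) (FSn_neq0 B).
  have hm' t : (h t != fset0) && (#|` h t| <= m)%N.
    have /andP[-> /=] := hcard t.
    have := FSn_neq0 A; have := FSn_neq0 B; rewrite -!cardfs_gt0.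
    have := FSn_card A; have := FSn_card B.
    by move: #|` A| #|` B| #|` h t| => a b c; lia.
  exists (fun t => MkFSn (hm' t)).
  by apply: lipschitz_geodesic => //; exact: val_inj.
split=> [n m hn hm Xgeo A B le_nm||Xgeo A B].
- exact: FSn_geodesic.
- split; last exact: geodesic_of_FSn.
  move=> Xgeo A B; have [g] := FSn_geodesic 2 2 isT isT (leqnn 2) A B Xgeo.
  have widen2 (E : FSn X 2) : FSn_widen (leqnn 2) E = E by exact: val_inj.
  by rewrite !widen2; exists g.
- have [h [h0 h1 hcard hlip]] :=
    interpolation_card Xgeo (FS_neq0 A) (FS_neq0 B).
  have hN t : h t != fset0 by have /andP[] := hcard t.
  exists (fun t => MkFS (hN t)).
  by apply: lipschitz_geodesic => //; exact: val_inj.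
Qed.
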